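(* Let $Q$ be a nonzero quadratic form on $\mathbb{F}_{q_1}/\mathbb{F}_q$ with rank $r_Q$, and let $\mathcal{C}_{Q,N}$ be the $\mathbb{F}_p$-linear code obtained by descending $\mathcal{C}_Q$ (as described in the context). For each $r$ with $1\le r\le m(m_2+1)$: (1) if $r_Q$ is even and $\epsilon=1$, then $d_r(\mathcal{C}_{Q,N})=\frac{q^M(q-1)}{p^rN}(p^r-1)(1-q^{-r_Q/2})$ for $r\le m$, and $d_r(\mathcal{C}_{Q,N})=\frac{q^M(q-1)}{p^rN}\bigl(p^r-1-q^{-r_Q/2}(q-1)\bigr)$ for $r>m$; (2) if $r_Q$ is even and $\epsilon=-1$, then $d_r(\mathcal{C}_{Q,N})=\frac{q^M(q-1)}{p^rN}(p^r-1)$ for $r\le mm_2$, and $d_r(\mathcal{C}_{Q,N})=\frac{q^M(q-1)}{p^rN}\bigl(p^r-1+q^{-r_Q/2}(p^{r-mm_2}-1)\bigr)$ for $r>mm_2$; (3) if $r_Q$ is odd, then $d_r(\mathcal{C}_{Q,N})=\frac{q^M(q-1)}{p^rN}(p^r-1)$.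
   Context: Let $p$ be an odd prime, $m\ge1$, $q=p^m$. Let $m_1,m_2$ be positive integers, $M=m_1+m_2$, $q_i=q^{m_i}$, $\mathbb{F}=\mathbb{F}_{q_1}\times\mathbb{F}_{q_2}$, $\mathbb{F}^\star=\mathbb{F}\setminus\{(0,0)\}$. $\mathrm{Tr}_{q^s/q}$ is the trace $\mathbb{F}_{q^s}\to\mathbb{F}_q$; $\eta$ is the quadratic character of $\mathbb{F}_q$ with $\eta(0)=0$. A quadratic form $Q$ on $\mathbb{F}_{q_1}/\mathbb{F}_q$ is a map $Q:\mathbb{F}_{q_1}\to\mathbb{F}_q$ with $Q(ax)=a^2Q(x)$ ($a\in\mathbb{F}_q$) such that $B_Q(x,y)=\frac12(Q(x+y)-Q(x)-Q(y))$ is $\mathbb{F}_q$-bilinear; rank $r_Q=m_1-\dim_{\mathbb{F}_q}\{x:B_Q(x,y)=0\ \forall y\}$; in suitable coordinates $Q=\sum_{i=1}^{r_Q}\lambda_ix_i^2$, $\lambda_i\in\mathbb{F}_q^*$, and $\varepsilon_Q=\eta(\lambda_1\cdots\lambda_{r_Q})$. $\epsilon=\varepsilon_Q(-1)^{(p-1)mr_Q/4}$ if $r_Q$ even, $\epsilon=\varepsilon_Q(-1)^{(p-1)m(r_Q+1)/4}$ if $r_Q$ odd. Let $\mathcal{C}_Q=\{(aQ(x)+\mathrm{Tr}_{q_2/q}(by))_{(x,y)\in\mathbb{F}^\star}:(a,b)\in\mathbb{F}_q\times\mathbb{F}_{q_2}\}$, of length $n=q^M-1$. Let $N$ be a positive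 divisor of $p-1$ with $\gcd(N,\frac{q-1}{p-1})=1$, and let $\theta$ be a primitive $\frac{q-1}{N}$-th root of unity in $\mathbb{F}_q$. For $\gamma\in\mathbb{F}_q$ let $\psi_\gamma=(\mathrm{Tr}_{q/p}(\gamma\theta^i))_{0\le i<\frac{q-1}{N}}\in\mathbb{F}_p^{(q-1)/N}$. Define $\mathcal{C}_{Q,N}=\{(\psi_{c_1},\dots,\psi_{c_n}):(c_1,\dots,c_n)\in\mathcal{C}_Q\}\subseteq\mathbb{F}_p^{n(q-1)/N}$ (concatenation), an $\mathbb{F}_p$-linear code. For a linear code $\mathcal{C}$ over $\mathbb{F}_p$ of dimension $k$ and $1\le r\le k$, $d_r(\mathcal{C})$ is the minimum of $\#\mathrm{Supp}(K)$ over $r$-dimensional $\mathbb{F}_p$-subspaces $K\subseteq\mathcal{C}$, where $\mathrm{Supp}(K)$ is the set of coordinates where some codeword of $K$ is nonzero. *)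

(* Defs.v *)
From HB Require Import structures.
From mathcomp Require Import all_boot all_order all_algebra all_field.
Set Implicit Arguments. Unset Strict Implicit. Unset Printing Implicit Defensive.
Import Order.TTheory GRing.Theory Num.Theory.
Local Open Scope ring_scope.

Definition qchar (K : finFieldType) (x : K) : int :=
  if x == 0 then 0 else if [exists y : K, y ^+ 2 == x] then 1 else -1.

(* Relative trace Tr_{k^s/k} : E -> F, where F is embedded in E via iota and
   |F| = k:  Tr(x) = x + x^k + ... + x^(k^(s-1)), read back in F. *)
Definition reltr (F : finFieldType) (E : fieldType) (iota : F -> E)
    (s k : nat) (x : E) : F :=
  odflt 0 [pick a : F | iota a == \sum_(i < s) x ^+ (k ^ i)].

Definition Fp_emb (p : nat) (K : finFieldType) (a : 'F_p) : K := (val a)%:R.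

Definition trqp (p m : nat) (K : finFieldType) (x : K) : 'F_p :=
  reltr (@Fp_emb p K) m p x.

Definition bilin_of (K L1 : finFieldType) (Q : L1 -> K) (x y : L1) : K :=
  (Q (x + y) - Q x - Q y) / 2%:R.

Definition is_qform (K L1 : finFieldType) (iota1 : {rmorphism K -> L1})
    (Q : L1 -> K) : Prop :=
  [/\ forall (a : K) (x : L1), Q (iota1 a * x) = a ^+ 2 * Q x,
      forall x x' y, bilin_of Q (x + x') y = bilin_of Q x y + bilin_of Q x' y,
      forall x y y', bilin_of Q x (y + y') = bilin_of Q x y + bilin_of Q x y',
      forall (a : K) x y, bilin_of Q (iota1 a * x) y = a * bilin_of Q x y
    & forall (a : K) x y, bilin_of Q x (iota1 a * y) = a * bilin_of Q x y].

Definition Fstar (L1 L2 : finFieldType) := {xy : L1 * L2 | xy != (0, 0)}.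

Definition cQ (K L1 L2 : finFieldType) (iota2 : K -> L2) (m2 q : nat)
    (Q : L1 -> K) (a : K) (b : L2) (xy : L1 * L2) : K :=
  a * Q xy.1 + reltr iota2 m2 q (b * xy.2).

(* The codeword of C_{Q,N} attached to (a,b): row j is psi_{c_j}, where
   c_j is the coordinate of the codeword of C_Q at the j-th point of F*;
   i.e. the concatenation (psi_{c_1}, ..., psi_{c_n}) laid out as a matrix
   (row j = block j). *)
Definition CQN_word (p m m2 : nat) (K L1 L2 : finFieldType) (iota2 : K -> L2)
    (Q : L1 -> K) (theta : K) (len : nat) (a : K) (b : L2)
    : 'M['F_p]_(#|{: Fstar L1 L2}|, len) :=
  \matrix_(j, i) trqp p m (cQ iota2 m2 (p ^ m) Q a b (val (enum_val j)) * theta ^+ i).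

Definition CQN (p m m2 : nat) (K L1 L2 : finFieldType) (iota2 : K -> L2)
    (Q : L1 -> K) (theta : K) (len : nat)
    : pred 'M['F_p]_(#|{: Fstar L1 L2}|, len) :=
  fun W => [exists a : K, exists b : L2, W == CQN_word p m m2 iota2 Q theta len a b].

Definition supp_vs (F : finFieldType) (n l : nat) (V : {vspace 'M[F]_(n, l)})
    : {set 'I_n * 'I_l} :=
  [set ij | [exists W : 'M[F]_(n, l), (W \in V) && (W ij.1 ij.2 != 0)]].

Definition is_GHW (F : finFieldType) (n l : nat) (C : pred 'M[F]_(n, l))
    (r d : nat) : Prop :=
  (exists V : {vspace 'M[F]_(n, l)},
      [/\ \dim V = r, {subset V <= C} & #|supp_vs V| = d]) /\
  (forall V : {vspace 'M[F]_(n, l)},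
      \dim V = r -> {subset V <= C} -> (d <= #|supp_vs V|)%N).

Definition GHW_eq (F : finFieldType) (n l : nat) (C : pred 'M[F]_(n, l))
    (r : nat) (x : rat) : Prop :=
  exists d : nat, is_GHW C r d /\ (d%:R : rat) = x.

(* Main.v *)
Require Import Defs.
From HB Require Import structures.
From mathcomp Require Import all_boot all_order all_algebra all_field.
From mathcomp Require Import ring zify.
Set Implicit Arguments.
Unset Strict Implicit.
Unset Printing Implicit Defensive.
Import Order.TTheory GRing.Theory Num.Theory.
Local Open Scope ring_scope.

(* On an r-dimensional subcode V, each coordinate of the support is nonzero on
   exactly p^r - p^(r-1) words, so #Supp(V) is determined by the sum of the
   Hamming weights of the words of V. The descent multiplies the weight of the
   word of C_Q attached to (a, b) by the constant q (p - 1) / (p N). That word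
   has q^(M-1) zeros when b <> 0, and q^m2 #{Q = 0} zeros when b = 0 <> a.
   Hence #Supp(V) is an affine function of h = #{a : (a, 0) in V}, whose slope
   has the sign of q^(m1-1) - #{Q = 0}, that is, of -eps for even rank and 0 for
   odd rank. It remains to maximise h <= min(p^r, q), or to minimise
   h >= max(1, p^(r - m m2)). *)

(** * Fibres of additive maps and traces *)

(** Translation by some [d] in [H] with [f d = t' - t] embeds the fibre over [t] into the fibre over
    [t'], so all fibres have the same size. *)
Lemma card_fiber (U T : finZmodType) (H : {pred U}) (f : U -> T) :
  zmod_closed H -> {morph f : u v / u + v} ->
  (forall t, exists2 h, h \in H & f h = t) ->
  forall t, (#|[pred h in H | f h == t]| * #|T| = #|H|)%N.
Proof.
move=> [H0 hB] fD f_surj.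
have HD u v : u \in H -> v \in H -> u + v \in H.
  by move=> uH vH; rewrite -[v]opprK; apply: (hB) => //; rewrite -[- v]add0r hB.
have le_fib t t' :
    (#|[pred h in H | f h == t]| <= #|[pred h in H | f h == t']|)%N.
  have [d dH fd] := f_surj (t' - t).
  have addI : injective (fun u => u + d) by apply: addIr.
  rewrite -(card_image addI); apply: subset_leq_card; apply/subsetP => u.
  case/imageP => v; rewrite inE => /andP[vH /eqP fv] ->.
  by rewrite inE HD // fD fv fd addrC subrK eqxx.
move=> t; rewrite mulnC -sum_nat_const -[RHS]sum1_card.
rewrite (partition_big f xpredT) //=.
apply: eq_bigr => t' _; rewrite sum1_card; apply/eqP.
by rewrite eqn_leq !le_fib.
Qed.

Lemma card_fiberT (U T : finZmodType) (f : U -> T) :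
  {morph f : u v / u + v} -> (forall t, exists u, f u = t) ->
  forall t, (#|[pred u | f u == t]| * #|T| = #|U|)%N.
Proof.
move=> fD f_surj t.
have -> // := card_fiber (H := predT) _ fD _ t.
by move=> t'; have [u fu] := f_surj t'; exists u.
Qed.

Section RelativeTrace.

Variables (F E : finFieldType) (iota : {rmorphism F -> E}) (s k : nat).
Hypotheses (cardF : #|F| = k) (cardE : #|E| = (k ^ s)%N).

Let tr : E -> F := reltr iota s k.

(** ['X^k - 'X] is the product of all ['X - a] over [F], so after [iota] its only roots are images
    of elements of [F]. *)
Lemma frobenius_fixed_in_base (y : E) : y ^+ k = y -> exists a, iota a = y.
Proof.
move=> yF.
have : (map_poly iota ('X^k - 'X)).[y] = 0.
  by rewrite rmorphB /= map_polyXn map_polyX !hornerE yF subrr.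
rewrite -cardF finField_genPoly rmorph_prod horner_prod => /eqP.
rewrite prodf_seq_eq0 => /hasP[a _] /=.
rewrite rmorphB /= map_polyX map_polyC !hornerE subr_eq0 => /eqP ->.
by exists a.
Qed.

Lemma expr_cardD (x y : E) i :
  (x + y) ^+ (k ^ i) = x ^+ (k ^ i) + y ^+ (k ^ i).
Proof.
have [p p_pr pF] := finPcharP F.
have pE : p \in [pchar E] by rewrite (fmorph_pchar iota).
have [l kE] : exists l, k = (p ^ l)%N.
  rewrite -cardF; have := card_pprimeChar (pF : p \in [pchar F]).
  by exists (logn p #|F|).
by rewrite kE exprDn_pchar // -expnM pnatX (pnatE _ p_pr) pE.
Qed.

Lemma reltrE x : iota (tr x) = \sum_(i < s) x ^+ (k ^ i).
Proof.
rewrite /tr /reltr; case: pickP => [a /eqP //|no_a]; exfalso.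
case: (frobenius_fixed_in_base (y := \sum_(i < s) x ^+ (k ^ i))); last first.
  by move=> a /eqP; rewrite no_a.
have expD (y z : E) : (y + z) ^+ k = y ^+ k + z ^+ k.
  by have := expr_cardD y z 1; rewrite expn1.
have k_gt0 : (0 < k)%N by rewrite -cardF; apply/card_gt0P; exists 0.
(* The [k]-th power shifts the conjugates cyclically, since [x ^+ (k ^ s) = x]. The sum is thus
   fixed and lies in [F]: the default value of [reltr] is never reached. *)
have -> : (\sum_(i < s) x ^+ (k ^ i)) ^+ k = \sum_(i < s) x ^+ (k ^ i.+1).
  rewrite (big_morph (fun y => y ^+ k) expD (id1 := 0)).
    by apply: eq_bigr => i _; rewrite -exprM expnSr.
  by rewrite expr0n; case: (k) k_gt0.
case: s cardE => [|s'] cardE'; first by rewrite !big_ord0.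
rewrite big_ord_recr big_ord_recl /= -cardE' expf_card expn0 expr1 addrC.
by [].
Qed.

Lemma reltrD x y : tr (x + y) = tr x + tr y.
Proof.
apply: (fmorph_inj iota); rewrite rmorphD /= !reltrE -big_split /=.
by apply: eq_bigr => i _; rewrite expr_cardD.
Qed.

Lemma reltrZ a x : tr (iota a * x) = a * tr x.
Proof.
apply: (fmorph_inj iota); rewrite rmorphM /= !reltrE mulr_sumr.
apply: eq_bigr => i _; rewrite exprMn -rmorphXn /=; congr (iota _ * _).
elim: (i : nat) => [|j IHj]; first by rewrite expn0 expr1.
by rewrite expnSr exprM IHj -cardF expf_card.
Qed.

(** A vanishing trace would give the polynomial [P], of degree below [k ^ s], all [k ^ s] elements
    of [E] as roots. *)
Lemma reltr_neq0 : (0 < s)%N -> exists x, tr x != 0.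
Proof.
move=> s_gt0; apply/existsP; apply: contraT; rewrite negb_exists => /forallP tr0.
have k_gt1 : (1 < k)%N by rewrite -cardF finNzRing_gt1.
pose P : {poly E} := \sum_(i < s) 'X^(k ^ i).
have P_root x : root P x.
  rewrite /root horner_sum; under eq_bigr do rewrite hornerXn.
  by rewrite -reltrE; have /negPn/eqP -> := tr0 x; rewrite rmorph0.
(* The coefficient of ['X] is 1: as [k > 1], only the term [i = 0] contributes to it. *)
have P_neq0 : P != 0.
  apply/eqP => /(congr1 (coefp 1)) /eqP; rewrite /= coef_sum coef0.
  rewrite (bigD1 (Ordinal s_gt0)) //= expn0 coefXn eqxx big1 ?addr0 ?oner_eq0 //.
  move=> i; rewrite -val_eqE /= coefXn => i_neq0.
  have := ltn_expl i k_gt1; case: eqP => //.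
  have := leq_pexp2l (ltnW k_gt1) (_ : (0 < i)%N); lia.
have := max_poly_roots P_neq0 (rs := enum E) (introT allP (fun x _ => P_root x)).
move=> /(_ (enum_uniq _)); rewrite -fintype.cardE cardE ltnNge => /negP[].
apply: leq_trans (size_sum _ _ _) _; apply/bigmax_leqP => i _.
by rewrite size_polyXn ltn_exp2l.
Qed.

Lemma reltr_surj : (0 < s)%N -> forall t, exists x, tr x = t.
Proof.
move=> /reltr_neq0[x trx] t.
by exists (iota (t / tr x) * x); rewrite reltrZ divfK.
Qed.

End RelativeTrace.

Section PrimeTrace.

Variables (p m : nat) (K : finFieldType).
Hypotheses (p_pr : prime p) (m_gt0 : (0 < m)%N) (cardK : #|K| = (p ^ m)%N).

Let pcharK : p \in [pchar K]. Proof. exact: card_finPcharP cardK p_pr. Qed.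

Lemma natr_modp (n : nat) : (n %% p)%:R = n%:R :> K.
Proof.
by rewrite {2}(divn_eq n p) natrD natrM (pcharf0 pcharK) mulr0 add0r.
Qed.

Lemma Fp_emb_nat (n : nat) : Fp_emb K (n%:R : 'F_p) = n%:R.
Proof. by rewrite /Fp_emb [val _]val_Fp_nat // natr_modp. Qed.

Lemma Fp_natE (a : 'F_p) : a = (val a)%:R.
Proof. by rewrite natr_Zp. Qed.

Lemma Fp_emb_zmod_morphism : zmod_morphism (@Fp_emb p K).
Proof.
move=> a b; apply/eqP; rewrite eq_sym subr_eq; apply/eqP.
rewrite -{1}(subrK b a) {1 2}(Fp_natE (a - b)) (Fp_natE b) -natrD.
by rewrite !Fp_emb_nat natrD.
Qed.

Lemma Fp_emb_monoid_morphism : monoid_morphism (@Fp_emb p K).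
Proof.
split; first exact: (Fp_emb_nat 1).
by move=> a b; rewrite (Fp_natE a) (Fp_natE b) -natrM !Fp_emb_nat natrM.
Qed.

Let emb : {rmorphism 'F_p -> K} :=
  HB.pack (@Fp_emb p K)
    (GRing.isZmodMorphism.Build _ _ _ Fp_emb_zmod_morphism)
    (GRing.isMonoidMorphism.Build _ _ _ Fp_emb_monoid_morphism).

Lemma trqpD (x y : K) : trqp p m (x + y) = trqp p m x + trqp p m y.
Proof. by apply: (reltrD emb) => //; apply: card_Fp. Qed.

Lemma trqp_Fp_mul (a : 'F_p) (x : K) : trqp p m (Fp_emb K a * x) = a * trqp p m x.
Proof. by apply: (reltrZ emb) => //; apply: card_Fp. Qed.

Lemma trqp_surj t : exists x : K, trqp p m x = t.
Proof. by apply: (reltr_surj emb) => //; apply: card_Fp. Qed.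

Lemma Fp_emb_onto (y : K) : y ^+ p = y -> exists a : 'F_p, Fp_emb K a = y.
Proof. by apply: (@frobenius_fixed_in_base _ _ emb p); apply: card_Fp. Qed.

End PrimeTrace.

(** * Generators of the unit group and the cosets of theta *)

Lemma finField_generator (F : finFieldType) :
  exists g : F, (#|F|.-1).-primitive_root g.
Proof.
have F_gt1 : (1 < #|F|)%N by apply: finNzRing_gt1.
have := @cyclic.has_prim_root F #|F|.-1 (rem 0 (enum F)).
rewrite -ltnS prednK ?(ltnW F_gt1) // F_gt1 rem_uniq ?enum_uniq //.
rewrite size_rem ?mem_enum // -cardE leqnn.
case/(_ isT _ isT isT)/hasP; last by move=> g _ g_prim; exists g.
apply/allP => x; rewrite mem_rem_uniq ?enum_uniq // !inE => /andP[x0 _].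
rewrite unity_rootE; apply/eqP/(mulfI x0); rewrite mulr1 -exprS prednK ?expf_card //.
exact: ltnW.
Qed.

Section GeneratorPowers.

Variables (F : finFieldType) (g : F).
Hypothesis g_prim : (#|F|.-1).-primitive_root g.

Lemma gen_neq0 : g != 0.
Proof.
have := prim_expr_order g_prim; have := finNzRing_gt1 F.
case: #|F| => [|[|n]] //= _; case: eqP => // ->; rewrite expr0n /= => /eqP.
by rewrite eq_sym oner_eq0.
Qed.

Lemma gen_powers (x : F) : x != 0 -> exists i, x = g ^+ i.
Proof.
move=> x0; case: (prim_rootP g_prim (x := x)) => [|i ->]; last by exists i.
have F_gt0 : (0 < #|F|)%N by apply/card_gt0P; exists 0.
by apply/(mulfI x0); rewrite mulr1 -exprS prednK ?expf_card.
Qed.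

End GeneratorPowers.

(* [theta ^+ i * c ^+ j], with [c] a generator of the units of [F_p], runs once
   through the units of [K]: raising to the power [l] recovers [j] modulo [N]. *)
Lemma sum_primitive_cosets (p m N : nat) (K : finFieldType) (theta : K)
    (G : K -> nat) :
  prime p -> (0 < m)%N -> #|K| = (p ^ m)%N ->
  (0 < N)%N -> (N %| p - 1)%N -> coprime N ((p ^ m - 1) %/ (p - 1)) ->
  ((p ^ m - 1) %/ N).-primitive_root theta ->
  (forall (a : 'F_p) x, a != 0 -> G (Fp_emb K a * x) = G x) ->
  (N * \sum_(i < (p ^ m - 1) %/ N) G (theta ^+ i) = \sum_(x : K | x != 0%R) G x)%N.
Proof.
move=> p_pr m_gt0 cardK N_gt0 Np Ns; set l := (_ %/ N)%N; set s := (_ %/ _)%N in Ns.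
move=> theta_prim G_inv.
have p_gt1 := prime_gt1 p_pr.
have p1s : ((p - 1) * s = p ^ m - 1)%N.
  rewrite mulnC divnK // -[X in (_ %| _ - X)%N](exp1n m) subn_exp.
  exact: dvdn_mulr.
have Nl : (N * l = p ^ m - 1)%N.
  by rewrite mulnC divnK // -p1s dvdn_mulr.
have [g] := finField_generator K; rewrite cardK -subn1 => g_prim.
have g_neq0 : g != 0.
  by apply: gen_neq0; rewrite cardK -subn1.
have th_neq0 : theta != 0.
  apply/eqP => th0; have := prim_expr_order theta_prim; rewrite th0 expr0n.
  have := prim_order_gt0 theta_prim; case: (l) => // ? _ /eqP.
  by rewrite eq_sym oner_eq0.
pose c := g ^+ s.
(* As [(p - 1) * s] is the order of [g], [c ^+ p = c], which places [c] in the prime field. *)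
have [a aE] : exists a : 'F_p, Fp_emb K a = c.
  apply: (Fp_emb_onto p_pr cardK); rewrite -{1}(subnK (ltnW p_gt1)) addn1 exprS.
  by rewrite -[c ^+ (p - 1)]exprM mulnC p1s (prim_expr_order g_prim) mulr1.
have a_neq0 : a != 0.
  apply: contra_neq (expf_neq0 s g_neq0) => a0; rewrite -/c -aE a0.
  exact: (Fp_emb_nat p_pr cardK 0).
have Gc j x : G (c ^+ j * x) = G x.
  elim: j => [|j IHj]; first by rewrite expr0 mul1r.
  by rewrite exprS -mulrA -{1}aE G_inv // IHj.
pose f (u : 'I_N * 'I_l) := c ^+ u.1 * theta ^+ u.2.
have c_neq0 : c != 0 by rewrite expf_neq0.
have f_inj : injective f.
  move=> [i1 j1] [i2 j2]; rewrite /f /= => fE.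
  have i12 : i1 = i2.
    have pow_l i j : (c ^+ i * theta ^+ j) ^+ l = g ^+ (s * i * l).
      rewrite exprMn -[theta ^+ j ^+ l]exprM mulnC exprM.
      by rewrite (prim_expr_order theta_prim) expr1n mulr1 -!exprM mulnA.
    have := congr1 (fun x => x ^+ l) fE; rewrite /= !pow_l => /eqP.
    rewrite (eq_prim_root_expr g_prim) -Nl => i12.
    (* Equal powers of [g] give [N] dividing [s * (j - i)]; [N] is coprime to [s], so it divides
       [j - i < N], which must be 0. *)
    have le_eq (i j : 'I_N) : (i <= j)%N ->
        (s * j * l == s * i * l %[mod N * l])%N -> i = j.
      move=> ij; rewrite eqn_mod_dvd ?leq_mul // -mulnBl -mulnBr.
      rewrite dvdn_pmul2r ?(prim_order_gt0 theta_prim) // Gauss_dvdr //.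
      move: ij; rewrite leq_eqVlt => /orP[/eqP ij _|ij]; first exact: val_inj.
      rewrite gtnNdvd ?subn_gt0 //.
      exact: leq_ltn_trans (leq_subr _ _) (ltn_ord j).
    by case: (leqP i1 i2) => [|/ltnW] /le_eq ->; rewrite // eq_sym.
  move: fE; rewrite i12 => /mulfI => /(_ (expf_neq0 _ c_neq0)) /eqP.
  rewrite (eq_prim_root_expr theta_prim) !modn_small // => /eqP j12.
  by congr (_, _); apply: val_inj.
have f_onto : f @: setT = [set x | x != 0].
  apply/eqP; rewrite eqEcard; apply/andP; split.
    by apply/subsetP => _ /imsetP[u _ ->]; rewrite inE mulf_neq0 ?expf_neq0.
  rewrite card_imset // cardsT card_prod !card_ord Nl -cardK.
  rewrite subn1 -(cardsC1 (0 : K)); apply: subset_leq_card.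
  by apply/subsetP => x; rewrite !inE.
rewrite [RHS](eq_bigl (mem (f @: setT))); last by move=> x; rewrite /= f_onto inE.
rewrite big_imset /=; last by move=> u v _ _; apply: f_inj.
rewrite [RHS](eq_bigl xpredT) => [|u]; last by rewrite inE.
rewrite [RHS](eq_bigr (fun u : 'I_N * 'I_l => G (theta ^+ u.2))) => [|u _];
  last exact: Gc.
rewrite -(pair_big xpredT xpredT (fun _ j => G (theta ^+ (j : 'I_l)))) /=.
by rewrite sum_nat_const card_ord.
Qed.

(** * Counting zeros of diagonal quadratic forms *)

Section QuadraticCharacter.

Variable K : finFieldType.
Hypothesis oddK : odd #|K|.

Let q : int := (#|K|)%:Z.

Lemma two_neq0 : 2%:R != 0 :> K.
Proof.
have [p p_pr pK] := finPcharP K; rewrite -(dvdn_pcharf pK).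
have [l cardK] : exists l, #|K| = (p ^ l)%N.
  by have := card_pprimeChar (pK : p \in [pchar K]); exists (logn p #|K|).
apply: contraTN oddK; rewrite dvdn_prime2 // => /eqP p2.
rewrite cardK p2 oddX orbF.
by have := finNzRing_gt1 K; rewrite cardK; case: l {cardK}.
Qed.

(** The order of [g] is even, so the parity of an exponent is well defined, and squares are exactly
    the even powers. *)
Lemma qchar_gen (g : K) i : (#|K|.-1).-primitive_root g ->
  qchar (g ^+ i) = (-1) ^+ i.
Proof.
move=> g_prim; have g0 := gen_neq0 g_prim.
rewrite /qchar expf_eq0 (negbTE g0) andbF.
case: ifPn => [/existsP[y /eqP yE]|].
  have y0 : y != 0.
    by apply: contra_neq (expf_neq0 i g0) => y0; rewrite -yE y0 expr0n.
  have [j jE] := gen_powers g_prim y0.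
  move: yE; rewrite jE -exprM => /eqP; rewrite (eq_prim_root_expr g_prim) => ij.
  have : j * 2 == i %[mod 2].
    rewrite -(@modn_dvdm #|K|.-1 (j * 2)) ?(eqP ij) ?modn_dvdm //;
    by rewrite dvdn2 -subn1 oddB ?oddK //; apply/card_gt0P; exists 0.
  rewrite !modn2 oddM andbF -signr_odd => /eqP.
  by case: (odd i).
rewrite negb_exists => /forallP no_root.
rewrite -signr_odd; case i_odd: (odd i) => //.
have := no_root (g ^+ i./2); rewrite -exprM muln2.
by rewrite -{2}(odd_double_half i) i_odd eqxx.
Qed.

Lemma qchar0 : qchar (0 : K) = 0.
Proof. by rewrite /qchar eqxx. Qed.

Lemma qcharM (x y : K) : qchar (x * y) = qchar x * qchar y.
Proof.
have [-> | x0] := eqVneq x 0; first by rewrite mul0r qchar0 mul0r.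
have [-> | y0] := eqVneq y 0; first by rewrite mulr0 qchar0 mulr0.
have [g g_prim] := finField_generator K.
have [i ->] := gen_powers g_prim x0; have [j ->] := gen_powers g_prim y0.
by rewrite -exprD !qchar_gen // exprD.
Qed.

Lemma qchar1 : qchar (1 : K) = 1.
Proof. by have [g g_prim] := finField_generator K; rewrite -(expr0 g) qchar_gen. Qed.

Lemma qcharX (x : K) i : qchar (x ^+ i) = qchar x ^+ i.
Proof.
by elim: i => [|i IHi]; rewrite ?expr0 ?qchar1 // !exprS qcharM IHi.
Qed.

Lemma qchar_sqr (x : K) : x != 0 -> qchar x * qchar x = 1.
Proof.
move=> x0; have [g g_prim] := finField_generator K.
by have [i ->] := gen_powers g_prim x0; rewrite qchar_gen // -expr2 sqrr_sign.
Qed.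

Lemma qcharV (x : K) : qchar x^-1 = qchar x.
Proof.
have [-> | x0] := eqVneq x 0; first by rewrite invr0.
by rewrite -[LHS]mul1r -(qchar_sqr x0) -mulrA -qcharM divff // qchar1 mulr1.
Qed.

(** The power of [g] with exponent half its order squares to 1 without being 1, so it is [-1]. *)
Lemma qcharN1 : qchar (-1 : K) = (-1) ^+ (#|K|.-1./2).
Proof.
have [g g_prim] := finField_generator K; rewrite -(qchar_gen _ g_prim).
have K1_gt0 := prim_order_gt0 g_prim.
have K1_half : (#|K|.-1./2 * 2 = #|K|.-1)%N.
  rewrite muln2 -[RHS]odd_double_half -subn1 oddB ?oddK //.
  by apply/card_gt0P; exists 0.
have : (g ^+ #|K|.-1./2) ^+ 2 == 1.
  by rewrite -exprM K1_half (prim_expr_order g_prim).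
rewrite sqrf_eq1 => /orP[|/eqP -> //].
rewrite -(expr0 g) (eq_prim_root_expr g_prim) mod0n modn_small; last first.
  by rewrite -[X in (_ < X)%N]K1_half; move: K1_gt0 K1_half; lia.
by move=> /eqP half0; move: K1_gt0; rewrite -K1_half half0.
Qed.

Lemma sum1_nonzero : \sum_(x : K | x != 0) (1 : int) = q - 1.
Proof.
have : \sum_(x : K) (1 : int) = q by rewrite sumr_const natz.
by rewrite (bigD1 0) //= => <-; rewrite addrAC subrr add0r.
Qed.

Lemma sum_sqr_eq (x : K) : \sum_(y : K) (y ^+ 2 == x)%:R = 1 + qchar x.
Proof.
rewrite /qchar; have [-> | x0] := eqVneq x 0.
  rewrite addr0 (bigD1 0) //= expr0n eqxx big1 ?addr0 // => y y0.
  by rewrite expf_eq0 (negbTE y0).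
case: ifPn => [/existsP[y /eqP yE]|]; last first.
  rewrite negb_exists => /forallP no_root.
  by rewrite subrr big1 // => y _; rewrite (negbTE (no_root y)).
have y0 : y != 0 by apply: contra_neq x0 => y0; rewrite -yE y0 expr0n.
have yN : - y != y.
  by rewrite -subr_eq0 -opprD oppr_eq0 -mulr2n -mulr_natl mulf_neq0 ?two_neq0.
rewrite (bigD1 y) //= (bigD1 (- y)) //= sqrrN yE eqxx big1 ?addr0 //.
by move=> z /andP[/negbTE zy /negbTE zNy]; rewrite -yE eqf_sqr zy zNy.
Qed.

(* The sum of psi(t) over the nontrivial additive characters psi of K. *)
Definition zero_wt (t : K) : int := if t == 0 then q - 1 else -1.

Lemma zero_wtE t : zero_wt t = q * (t == 0)%:R - 1.
Proof. by rewrite /zero_wt; case: eqP => _; rewrite ?mulr1 ?mulr0 ?sub0r. Qed.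

(** This and [sum_qchar_quadratic] are the two halves of the induction on variables: a new square
    turns [zero_wt] into [qchar], and [qchar] back into [zero_wt]. *)
Lemma sum_zero_wt (l t : K) : l != 0 ->
  \sum_x zero_wt (t - l * x ^+ 2) = q * qchar (l * t).
Proof.
move=> l0; under eq_bigr do rewrite zero_wtE.
rewrite big_split /= -mulr_sumr sumr_const mulNrn natz.
rewrite (eq_bigr (fun x => (x ^+ 2 == t / l)%:R)); last first.
  move=> x _; rewrite subr_eq0; congr (nat_of_bool _)%:R.
  by rewrite -[RHS](inj_eq (mulfI l0)) [l * (t / l)]mulrC divfK // eq_sym.
by rewrite sum_sqr_eq qcharM qcharV qcharM; ring.
Qed.

(** The points of the hyperbola [y ^+ 2 = x ^+ 2 - c] are counted twice: [q - 1] after factoring,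
    and [q] plus the wanted sum when counted over [x]. *)
Lemma sum_qchar_sqr_sub (c : K) : c != 0 -> \sum_x qchar (x ^+ 2 - c) = -1.
Proof.
move=> c0.
have : \sum_(x : K) \sum_(y : K) (y ^+ 2 == x ^+ 2 - c)%:R = q - 1.
  rewrite pair_big /=.
  (* In the coordinates [x - y] and [x + y] the equation says that their product is [c]. *)
  rewrite (reindex (fun u : K * K => ((u.1 + u.2) / 2%:R, (u.2 - u.1) / 2%:R))).
    rewrite (eq_bigr (fun u : K * K => (u.1 * u.2 == c)%:R)); last first.
      move=> u _; congr (nat_of_bool _)%:R; rewrite /= -[LHS]subr_eq0 -[RHS]subr_eq0.
      rewrite -[RHS]oppr_eq0; congr (_ == _); field; exact: two_neq0.
    rewrite -(pair_big xpredT xpredT (fun u w => (u * w == c)%:R)) /=.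
    rewrite (bigD1 0) //= big1 ?add0r; last first.
      by move=> w _; rewrite mul0r eq_sym (negbTE c0).
    rewrite (eq_bigr (fun=> 1)) => [|u u0]; last first.
      rewrite (bigD1 (c / u)) //= mulrCA divff // mulr1 eqxx big1 ?addr0 // => w.
      move=> wc; case: eqP => // uw; move: wc.
      by rewrite -uw mulrAC divff // mul1r eqxx.
    exact: sum1_nonzero.
  exists (fun x : K * K => (x.1 - x.2, x.1 + x.2)) => -[u w] _ /=;
    congr (_, _); field; exact: two_neq0.
under eq_bigr do rewrite sum_sqr_eq.
rewrite big_split /= sumr_const natz => /(canRL (addKr _)) ->.
by rewrite addrA addNr add0r.
Qed.

Lemma sum_qchar_quadratic (l t : K) : l != 0 ->
  \sum_x qchar (t - l * x ^+ 2) = qchar (- l) * zero_wt t.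
Proof.
move=> l0.
rewrite (eq_bigr (fun x => qchar (- l) * qchar (x ^+ 2 - t / l))); last first.
  move=> x _; rewrite -qcharM; congr qchar; field; exact: l0.
rewrite -mulr_sumr /zero_wt; congr (_ * _); case: eqP => [-> | /eqP t0].
  rewrite mul0r (bigD1 0) //= expr0n subrr qchar0 add0r.
  rewrite (eq_bigr (fun=> 1)) => [|u u0]; last first.
    by rewrite subr0 qcharX expr2 qchar_sqr.
  exact: sum1_nonzero.
by apply: sum_qchar_sqr_sub; rewrite mulf_neq0 ?invr_eq0.
Qed.

End QuadraticCharacter.

Section DiagonalForms.

Variable K : finFieldType.
Hypothesis oddK : odd #|K|.

Let q : int := (#|K|)%:Z.

Definition diag_count n (lam : 'I_n -> K) (t : K) : int :=
  \sum_(c : 'rV[K]_n) (\sum_i lam i * c 0 i ^+ 2 == t)%:R.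

Lemma diag_count_recl n (lam : 'I_n.+1 -> K) t :
  diag_count lam t =
  \sum_x diag_count (fun i => lam (lift ord0 i)) (t - lam ord0 * x ^+ 2).
Proof.
rewrite /diag_count pair_big /=.
pose cons_row (u : K * 'rV[K]_n) : 'rV[K]_n.+1 :=
  \row_i oapp (u.2 0) u.1 (unlift ord0 i).
have cons0 u : cons_row u 0 ord0 = u.1 by rewrite mxE unlift_none.
have consS u i : cons_row u 0 (lift ord0 i) = u.2 0 i by rewrite mxE liftK.
rewrite (reindex cons_row) /=.
  apply: eq_bigr => u _; congr (nat_of_bool _)%:R.
  rewrite big_ord_recl cons0; under [in LHS]eq_bigr do rewrite consS.
  by rewrite [RHS]eq_sym subr_eq [RHS]eq_sym addrC.
exists (fun c => (c 0 ord0, \row_j c 0 (lift ord0 j))) => [[x c]|c] _ /=.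
  by rewrite cons0; congr (_, _); apply/rowP => i; rewrite mxE consS.
apply/rowP => i; case: (unliftP ord0 i) => [j|] ->; rewrite ?cons0 ?consS //.
by rewrite mxE.
Qed.

(** Induction on [n], removing the first variable: a zero coefficient multiplies the deviation from
    [q ^+ n] by [q], a nonzero one swaps [zero_wt] and [qchar]. The factor [q] on the left avoids an
    exponent [n - 1]. *)
Lemma diag_countE n (lam : 'I_n -> K) (t : K)
    (k := (\sum_i (lam i != 0%R))%N) :
  q * diag_count lam t = q ^+ n + q ^+ (n - k./2) *
    (if odd k then qchar t else zero_wt t) *
    qchar ((-1) ^+ k./2 * \prod_(i | lam i != 0) lam i).
Proof.
rewrite {}/k; elim: n lam t => [|n IHn] lam t.
  rewrite !big_ord0 /= !expr0 !mulr1 qchar1 // mulr1 mul1r.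
  rewrite /diag_count (bigD1 0) //= big_ord0 big1 ?addr0; last first.
    by move=> c /eqP[]; apply/rowP; case.
  by rewrite zero_wtE eq_sym addrC subrK.
rewrite diag_count_recl mulr_sumr; under [LHS]eq_bigr do rewrite IHn.
rewrite big_split /= sumr_const -mulr_suml -mulr_sumr big_ord_recl.
have -> : \prod_(i | lam i != 0) lam i = (if lam ord0 != 0 then lam ord0 else 1)
    * \prod_(i < n | lam (lift ord0 i) != 0) lam (lift ord0 i).
  by rewrite big_mkcond big_ord_recl -big_mkcond.
set k := (\sum_(i < n) _)%N; set D := \prod_(i < n | _) _.
have k_le : (k <= n)%N.
  rewrite -[X in (_ <= X)%N]muln1 -[X in (_ <= X * _)%N](card_ord n) -sum_nat_const.
  by apply: leq_sum => i _; case: (_ != _).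
have k2_le : (k./2 <= n)%N by lia.
have qn : q ^+ n *+ #|K| = q ^+ n.+1 by rewrite exprSr -mulr_natr natz.
rewrite -[X in X + _ = _]/(q ^+ n *+ #|K|) qn; congr (_ + _).
have [l0 | l0] := eqVneq (lam ord0) 0.
  rewrite /= add0n mul1r subSn // exprSr.
  rewrite (eq_bigr (fun=> if odd k then qchar t else zero_wt t)); last first.
    by move=> x _; rewrite l0 mul0r subr0.
  by rewrite sumr_const -[_ *+ _]mulr_natr natz -/q; ring.
(* Passing from odd to even [k] yields [qchar (- lam ord0)], the source of the sign
   [(-1) ^+ k./2]. *)
rewrite /= add0n uphalf_half; case: (odd k) => /=; rewrite ?add0n ?add1n.
  rewrite sum_qchar_quadratic // exprS subSS -mulrA -[RHS]mulrA; congr (_ * _).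
  rewrite [LHS]mulrAC -qcharM // [LHS]mulrC; congr (_ * qchar _); ring.
rewrite sum_zero_wt // subSn // exprSr !qcharM //; ring.
Qed.

End DiagonalForms.

(** * Supports of subspaces *)

Lemma sum_nat_bool (T : finType) (A P : pred T) :
  (\sum_(x | A x) (P x : nat) = #|[pred x | A x & P x]|)%N.
Proof. by rewrite -sum1_card big_mkcondr; apply: eq_bigr => x _; case: (P x). Qed.

Lemma sum_nat_boolT (T : finType) (P : pred T) :
  (\sum_x (P x : nat) = #|[pred x | P x]|)%N.
Proof. exact: sum_nat_bool. Qed.

Section Supports.

Variables (F : finFieldType) (n l : nat).

Definition hamming (W : 'M[F]_(n, l)) : nat :=
  (\sum_(ij : 'I_n * 'I_l) (W ij.1 ij.2 != 0%R))%N.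

(* A nonzero coordinate functional on [V] takes every value equally often. *)
Lemma sum_hamming (V : {vspace 'M[F]_(n, l)}) :
  (\sum_(W in V) hamming W * #|F| = #|supp_vs V| * (#|F|.-1 * #|V|))%N.
Proof.
under eq_bigr do rewrite /hamming.
rewrite -big_distrl exchange_big big_distrl /=.
rewrite -sum_nat_const [RHS]big_mkcond /=.
apply: eq_bigr => -[i j] _ /=.
pose coef (W : 'M[F]_(n, l)) := W i j.
have coefD : {morph coef : W W' / W + W'} by move=> W W'; rewrite /coef mxE.
rewrite inE; case: ifPn => [/existsP[W /= /andP[WV Wij]]|]; last first.
  rewrite negb_exists => /forallP V0; rewrite big1 // => W WV.
  by have := V0 W; rewrite /= WV /= negbK => /eqP ->; rewrite eqxx.
have V_closed : zmod_closed (mem V).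
  by split=> [|W1 W2]; [apply: mem0v | apply: memvB].
have V_surj t : exists2 W1, W1 \in mem V & coef W1 = t.
  exists (t / W i j *: W); first exact: memvZ.
  by rewrite /coef mxE divfK.
have fib := card_fiber V_closed coefD V_surj 0.
rewrite sum_nat_bool; set Y := #|_|; move: fib => /=; set X := #|_| => fib.
have {}fib : (X * #|F| = #|V|)%N by [].
have XY : (X + Y = #|V|)%N.
  rewrite /X /Y -!sum_nat_bool -big_split -sum1_card /=.
  by apply: eq_bigr => W1 _; case: eqP.
have F_gt0 : (0 < #|F|)%N by apply/card_gt0P; exists 0.
(* [X] counts the words vanishing at the coordinate and [Y] the others; adding [X * #|F| = #|V|] to
   both sides leaves [(X + Y) * #|F|] against [#|F| * #|V|]. *)
apply: (@addnI (X * #|F|)%N).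
by rewrite -mulnDl XY fib -mulSn prednK // mulnC.
Qed.

End Supports.

Lemma exists_subvs_dim (F : fieldType) (vT : vectType F) (W : {vspace vT}) r :
  (r <= \dim W)%N -> exists2 V : {vspace vT}, (V <= W)%VS & \dim V = r.
Proof.
move=> rW; exists <<take r (vbasis W)>>%VS.
  by apply/span_subvP => v /mem_take; apply: vbasis_mem.
have /catl_free : free (take r (vbasis W) ++ drop r (vbasis W)).
  by rewrite cat_take_drop (basis_free (vbasisP W)).
by rewrite /free => /eqP ->; rewrite size_takel // size_tuple.
Qed.

(** Subspaces nested with [A] will realise the extreme values of [h]. Above [\dim A], a piece of a
    complement of [A] in [W] is adjoined. *)
Lemma exists_subvs_between (F : fieldType) (vT : vectType F)
    (A W : {vspace vT}) r :
  (A <= W)%VS -> (r <= \dim W)%N ->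
  exists V : {vspace vT}, [/\ (V <= W)%VS, \dim V = r,
    (r <= \dim A)%N -> (V <= A)%VS & (\dim A <= r)%N -> (A <= V)%VS].
Proof.
move=> AW rW; case: (leqP r (\dim A)) => rA.
  have [V VA dimV] := exists_subvs_dim rA.
  exists V; split=> // [|Ar]; first exact: subv_trans AW.
  by have /eqP -> : V == A; rewrite ?subvv // eqEdim VA dimV.
have dimWA : (\dim A + \dim (W :\: A) = \dim W)%N.
  by rewrite -(dimv_cap_compl W A) (capv_idPr AW).
have [|B BW dimB] := @exists_subvs_dim _ _ (W :\: A)%VS (r - \dim A)%N.
  by rewrite leq_subLR dimWA.
exists (A + B)%VS; split=> //.
- by rewrite subv_add AW (subv_trans BW) ?diffvSl.
- rewrite dimv_disjoint_sum ?dimB ?subnKC ?(ltnW rA) //.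
  apply/eqP; rewrite -subv0 -(capv_diff W A) capvC.
  by apply: capvS.
- by move=> _; apply: addvSl.
Qed.

(** Over ['F_p] a scalar multiple is a repeated sum, so closure under addition is enough. *)
Lemma additive_set_vspace (p : nat) (vT : vectType 'F_p) (s : seq vT) :
  0 \in s -> (forall x y, x \in s -> y \in s -> x + y \in s) ->
  exists V : {vspace vT}, V =i s.
Proof.
move=> s0 sD; exists <<s>>%VS => v; apply/idP/idP; last exact: memv_span.
rewrite -[s]/(tval (in_tuple s)) => /coord_span ->.
elim/big_ind: _ => // i _; set a := coord _ _ _.
have -> : a *: (in_tuple s)`_i = (in_tuple s)`_i *+ (a : nat).
  by rewrite -scaler_nat natr_Zp.
have si : (in_tuple s)`_i \in s by rewrite mem_nth.
by elim: (a : nat) => [|k IHk]; rewrite ?mulr0n // mulrS sD.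
Qed.

(** * Weights in the descended code *)

Section DescendedCode.

Variables (p m m1 m2 N : nat) (K L1 L2 : finFieldType).
Variables (iota2 : {rmorphism K -> L2}) (Q : L1 -> K) (theta : K).
Hypotheses (p_pr : prime p) (m_gt0 : (0 < m)%N) (m2_gt0 : (0 < m2)%N).

Let q := (p ^ m)%N.
Let len := ((q - 1) %/ N)%N.

Hypotheses (cardK : #|K| = q) (cardL1 : #|L1| = (q ^ m1)%N)
  (cardL2 : #|L2| = (q ^ m2)%N).
Hypotheses (N_gt0 : (0 < N)%N) (N_dvd : (N %| p - 1)%N)
  (N_coprime : coprime N ((q - 1) %/ (p - 1))).
Hypothesis theta_prim : len.-primitive_root theta.
Hypotheses (Q0 : Q 0 = 0) (Q_neq0 : exists x, Q x != 0).

Let Tr2 := reltr iota2 m2 q.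
Let value a b := cQ iota2 m2 q Q a b.
Let word a b := CQN_word p m m2 iota2 Q theta len a b.
Let zeros := #|[pred x | Q x == 0]|.

Let Tr2D x y : Tr2 (x + y) = Tr2 x + Tr2 y.
Proof. exact: reltrD cardK cardL2 x y. Qed.

Let Tr2Z a x : Tr2 (iota2 a * x) = a * Tr2 x.
Proof. exact: reltrZ cardK cardL2 a x. Qed.

Let Tr2_surj t : exists x, Tr2 x = t.
Proof. exact: reltr_surj cardK cardL2 m2_gt0 t. Qed.

Let Tr2_0 : Tr2 0 = 0.
Proof. by rewrite -[0 in LHS](mul0r 0) -(rmorph0 iota2) Tr2Z mul0r. Qed.

Let trD (x y : K) : trqp p m (x + y) = trqp p m x + trqp p m y.
Proof. exact: trqpD. Qed.

Let tr0 : trqp p m (0 : K) = 0.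
Proof. by apply: (addrI (trqp p m (0 : K))); rewrite -trD !addr0. Qed.

Lemma valueD a b a' b' xy :
  value (a + a') (b + b') xy = value a b xy + value a' b' xy.
Proof. by rewrite /value /cQ !mulrDl -/Tr2 Tr2D; ring. Qed.

Lemma wordD a b a' b' : word (a + a') (b + b') = word a b + word a' b'.
Proof.
by apply/matrixP => j i; rewrite !mxE [cQ _ _ _ _ _ (_ + _) _]valueD mulrDl trD.
Qed.

(** [N] copies of the powers of [theta] stand for all units of [K], and for [c != 0] the trace of
    [c * x] is nonzero for [q - q / p] values of [x]. Clearing denominators keeps the identity in
    [nat]. *)
Lemma count_nonzero_descent (c : K) :
  (N * (\sum_(i < len) (trqp p m (c * theta ^+ i)%R != 0%R)) * p
   = (c != 0%R) * (q * p.-1))%N.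
Proof.
have p_gt0 := prime_gt0 p_pr.
rewrite (sum_primitive_cosets (G := fun x => (trqp p m (c * x) != 0) : nat)
  p_pr m_gt0 cardK N_gt0 N_dvd N_coprime theta_prim); last first.
  move=> a x a0; rewrite mulrCA trqp_Fp_mul // mulf_eq0 (negbTE a0).
  by [].
have [-> | c0] := eqVneq c 0.
  by rewrite big1 // => x _; rewrite mul0r tr0 eqxx.
rewrite big_mkcond (eq_bigr (fun x => (trqp p m (c * x)%R != 0%R) : nat)) /=; last first.
  by move=> x _; case: eqVneq => // ->; rewrite mulr0 tr0 eqxx.
rewrite (reindex_inj (mulfI (invr_neq0 c0))) /=.
under eq_bigr do rewrite mulVKf //.
rewrite sum_nat_bool mul1n.
have := card_fiberT trD (trqp_surj p_pr m_gt0 cardK) 0.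
rewrite (card_Fp p_pr) cardK => kerE; apply: (@addnI (q * 1)%N).
rewrite -mulnDr add1n prednK // muln1 -{1}kerE -mulnDl -cardK; congr (_ * _)%N.
exact: cardC.
Qed.

Lemma hamming_word a b :
  (N * hamming (word a b) * p = #|[pred xy | value a b xy != 0%R]| * (q * p.-1))%N.
Proof.
rewrite /hamming -(pair_big xpredT xpredT (fun j i => word a b j i != 0%R : nat)) /=.
rewrite big_distrr big_distrl /=
  -(sum_nat_boolT (fun xy => value a b xy != 0)) big_distrl /=.
pose F xy := ((value a b xy != 0%R) * (q * p.-1))%N.
rewrite (eq_bigr (fun j => F (val (enum_val j)))) => [|j _]; last first.
  rewrite /F -count_nonzero_descent; congr (_ * _ * _)%N.
  by apply: eq_bigr => i _; rewrite mxE.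
rewrite -(big_enum_val (fun u : Fstar L1 L2 => F (val u))) /=.
(* The excluded point [(0, 0)] may be restored, as every word of the code vanishes there. *)
rewrite -(big_sub [pred xy : L1 * L2 | xy != (0, 0)] F) /= big_mkcond.
apply: eq_bigr => xy _; rewrite inE; case: eqVneq => // ->.
by rewrite /value /cQ /= Q0 mulr0 mulr0 -/Tr2 Tr2_0 addr0 eqxx.
Qed.

(** For each fixed [x], the map sending [y] to [Tr2 (b * y)] is onto [K], so it hits [- (a * Q x)]
    equally often whatever [x] is. *)
Lemma card_value_zeros a b : b != 0 ->
  (#|[pred xy | value a b xy == 0%R]| * q = q ^ (m1 + m2))%N.
Proof.
move=> b0; rewrite -sum_nat_boolT expnD -cardL1 -cardL2 -cardK.
rewrite -(pair_big xpredT xpredT (fun x y => value a b (x, y) == 0%R : nat)) /=.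
rewrite big_distrl /= -sum_nat_const; apply: eq_bigr => x _.
rewrite sum_nat_boolT.
have bD : {morph (fun y => Tr2 (b * y)) : u v / u + v}.
  by move=> u v; rewrite mulrDr Tr2D.
rewrite -(card_fiberT bD _ (- (a * Q x))) => [|t]; last first.
  by have [y <-] := Tr2_surj t; exists (y / b); rewrite mulrCA divff // mulr1.
congr (_ * _)%N; apply: eq_card => y; rewrite !inE /value /cQ /=.
by rewrite addrC addr_eq0.
Qed.

Lemma card_value_zeros0 a : a != 0 ->
  (#|[pred xy | value a 0%R xy == 0%R]| = zeros * q ^ m2)%N.
Proof.
move=> a0; rewrite -sum_nat_boolT -cardL2.
rewrite -(pair_big xpredT xpredT (fun x y => value a 0 (x, y) == 0%R : nat)) /=.
rewrite /zeros -sum_nat_boolT big_distrl /=; apply: eq_bigr => x _.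
rewrite mulnC -sum_nat_const; apply: eq_bigr => y _.
by rewrite /value /cQ /= mul0r -/Tr2 Tr2_0 addr0 mulf_eq0 (negbTE a0).
Qed.

(** Weight zero forces [value a b] to vanish everywhere by [hamming_word]; points [(x, 0)] and
    [(0, y / b)] then detect [a] and [b]. Subcodes thus correspond to additive sets of pairs. *)
Lemma word_eq0 a b : word a b = 0 -> a = 0 /\ b = 0.
Proof.
move=> w0; have value0 xy : value a b xy = 0.
  apply/eqP; apply: contraT => vxy.
  have := hamming_word a b; rewrite /hamming big1 => [|ij _]; last first.
    by rewrite w0 mxE eqxx.
  rewrite muln0 mul0n => /esym/eqP; rewrite !muln_eq0.
  have q_gt0 : (0 < q)%N by rewrite expn_gt0 prime_gt0.
  have p1_gt0 : (0 < p.-1)%N by rewrite -subn1 subn_gt0 prime_gt1.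
  rewrite (gtn_eqF q_gt0) (gtn_eqF p1_gt0) !orbF => /eqP/card0_eq/(_ xy).
  by rewrite inE vxy.
have a0 : a = 0.
  have [x Qx] := Q_neq0; have := value0 (x, 0).
  rewrite /value /cQ /= mulr0 -/Tr2 Tr2_0 addr0 => /eqP.
  by rewrite mulf_eq0 (negbTE Qx) orbF => /eqP.
split=> //; apply/eqP; apply: contraT => b0; have [y y1] := Tr2_surj 1.
have := value0 (0, y / b); rewrite /value /cQ /= Q0 mulr0 add0r.
by rewrite mulrCA divff // mulr1 -/Tr2 y1 => /eqP; rewrite oner_eq0.
Qed.

Lemma word_inj a b a' b' : word a b = word a' b' -> a = a' /\ b = b'.
Proof.
move=> ww; have := wordD (a - a') (b - b') a' b'; rewrite !subrK ww.
move=> /esym/(canRL (addrK _)); rewrite subrr => /word_eq0[/eqP + /eqP].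
by rewrite !subr_eq0 => /eqP -> /eqP ->.
Qed.

Lemma word0 : word 0 0 = 0.
Proof. by apply: (addrI (word 0 0)); rewrite -wordD !addr0. Qed.

Let code := @CQN p m m2 K L1 L2 iota2 Q theta len.

Lemma codeP W : reflect (exists u, W = word u.1 u.2) (W \in code).
Proof.
apply: (iffP existsP) => [[a /existsP[b /eqP ->]]|[[a b] ->]].
  by exists (a, b).
by exists a; apply/existsP; exists b.
Qed.

(** * Support size of a subcode *)

Section Subcode.

Variables (V : {vspace 'M['F_p]_(#|{: Fstar L1 L2}|, len)}) (r : nat).
Hypotheses (V_code : {subset V <= code}) (dimV : \dim V = r).

(** Apart from the dimension, the only invariant of [V] that enters the size of its support. *)
Definition subcode_head := #|[pred a | word a 0 \in V]|.
Let h := subcode_head.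

Lemma sum_subcode (G : 'M['F_p]_(#|{: Fstar L1 L2}|, len) -> nat) :
  (\sum_(W in V) G W = \sum_(u | word u.1 u.2 \in V) G (word u.1 u.2))%N.
Proof.
pose H := [set u | word u.1 u.2 \in V].
rewrite (eq_bigl (mem [set word u.1 u.2 | u in H])) => [|W].
  rewrite big_imset => [|u v _ _] /=.
    by apply: eq_bigl => u; rewrite inE.
  by case: u v => [a b] [a' b'] /word_inj[/= -> ->].
apply/idP/imsetP => [WV|[u + ->]]; last by rewrite inE.
have /codeP[u uE] := V_code WV.
by exists u; rewrite // inE -uE.
Qed.

Lemma card_subcode : #|V| = (p ^ r)%N.
Proof. by rewrite card_vspace card_Fp // dimV. Qed.

Lemma card_subcode_pairs : #|[pred u | word u.1 u.2 \in V]| = (p ^ r)%N.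
Proof.
have := sum_subcode (fun=> 1%N); rewrite !sum1_card -card_subcode => ->.
by rewrite -sum1_card.
Qed.

Lemma head_ge1 : (0 < h)%N.
Proof. by apply/card_gt0P; exists 0; rewrite inE word0 mem0v. Qed.

Lemma head_le_q : (h <= q)%N.
Proof. by rewrite -cardK max_card. Qed.

Lemma head_le_card : (h <= p ^ r)%N.
Proof.
rewrite -card_subcode_pairs /h /subcode_head.
rewrite -(card_image (f := fun a : K => (a, 0 : L2))).
  by apply: subset_leq_card; apply/subsetP => _ /imageP[a aV ->]; rewrite inE.
by move=> a a' [].
Qed.

(** Group the words by [b]: each of the [q ^ m2] fibres is empty or, after subtracting one of its
    members, embeds into the words with [b = 0]. *)
Lemma card_le_head : (p ^ r <= h * q ^ m2)%N.
Proof.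
rewrite -card_subcode_pairs -sum1_card -cardL2 mulnC -sum_nat_const.
rewrite (partition_big (fun u : K * L2 => u.2) xpredT) //=.
apply: leq_sum => b _; rewrite sum1_card.
set B := #|_|; have [-> //|/card_gt0P[[a0 b0]]] := posnP B; rewrite {}/B.
rewrite unfold_in /= => /andP[a0V /eqP b0b]; subst b0.
rewrite /h /subcode_head -(card_in_image (f := fun u : K * L2 => u.1 - a0)).
  apply: subset_leq_card; apply/subsetP => _ /imageP[[a b'] /= + ->].
  rewrite unfold_in /= inE /= => /andP[aV /eqP bb]; rewrite bb in aV.
  have := wordD (a - a0) 0 a0 b; rewrite subrK add0r.
  by move=> /esym/(canRL (addrK _)); rewrite inE => ->; rewrite memvB.
move=> [a b1] [a' b2]; rewrite !unfold_in /= => /andP[_ /eqP ->] /andP[_ /eqP ->].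
by move/addIr => ->.
Qed.

(** Stated over the integers because the coefficient of [h - 1] can have either sign. *)
Lemma card_supp_subcode :
  ((N * #|supp_vs V| * p ^ r)%N)%:Z =
    ((p ^ r)%:Z - 1) * (q%:Z ^+ (m1 + m2).+1 - q%:Z ^+ (m1 + m2))
    + (h%:Z - 1) * (q%:Z ^+ (m1 + m2) - q%:Z ^+ m2 * (q%:Z * zeros%:Z)).
Proof.
have p1_gt0 : (0 < p.-1)%N by rewrite -subn1 subn_gt0 prime_gt1.
have q_gt0 : (0 < q)%N by rewrite expn_gt0 prime_gt0.
pose nz (u : K * L2) := #|[pred xy | value u.1 u.2 xy != 0]|.
have suppE : (N * #|supp_vs V| * p ^ r = \sum_(u | word u.1 u.2 \in V) nz u * q)%N.
  apply/eqP; rewrite -(eqn_pmul2r p1_gt0); apply/eqP.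
  have := sum_hamming V; rewrite card_Fp // card_subcode => /(congr1 (muln N)).
  rewrite mulnA mulnA [(_ * p.-1)%N]mulnC -!mulnA [(p.-1 * _)%N]mulnC !mulnA => <-.
  rewrite (sum_subcode (fun W => hamming W * p)%N) big_distrr big_distrl /=.
  by apply: eq_bigr => u _; rewrite mulnA hamming_word mulnA.
rewrite suppE.
have qZ k : (q ^ k)%:Z = q%:Z ^+ k by rewrite -!natz natrX.
(* The generic weight for [b != 0], a correction for [b = 0], and a last one bringing the zero pair
   to weight 0. Summed over [V] they count [p ^ r], [h] and 1 times. *)
have nzE u : (nz u * q)%:Z = (q%:Z ^+ (m1 + m2).+1 - q%:Z ^+ (m1 + m2))
    + (u.2 == 0)%:R * (q%:Z ^+ (m1 + m2) - q%:Z ^+ m2 * (q%:Z * zeros%:Z))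
    - (u == 0)%:R * (q%:Z ^+ (m1 + m2).+1 - q%:Z ^+ m2 * (q%:Z * zeros%:Z)).
  case: u => a b; rewrite /nz /=.
  pose z := #|[pred xy | value a b xy == 0]|.
  have zE : (z + #|[pred xy | value a b xy != 0%R]| = q ^ (m1 + m2))%N.
    by rewrite expnD -cardL1 -cardL2 -card_prod; apply: cardC.
  have -> : (#|[pred xy | value a b xy != 0]| * q)%:Z
      = q%:Z ^+ (m1 + m2).+1 - (z * q)%:Z.
    by rewrite exprS -qZ -zE; lia.
  rewrite -[(a, b) == 0]/((a == 0) && (b == 0)) {zE}/z.
  have [-> | b0] := eqVneq b 0; last first.
    by rewrite card_value_zeros // qZ andbF /=; ring.
  have [-> | a0] := eqVneq a 0; last first.
    by rewrite card_value_zeros0 // !PoszM qZ /=; ring.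
  have -> : #|[pred xy | value 0 0 xy == 0]| = (q ^ (m1 + m2))%N.
    rewrite expnD -cardL1 -cardL2 -card_prod; apply: eq_card => xy.
    by rewrite inE /value /cQ !mul0r -/Tr2 Tr2_0 addr0 eqxx.
  by rewrite PoszM qZ /= exprSr; ring.
rewrite -[LHS]natz natr_sum; under eq_bigr do rewrite natz nzE.
rewrite !big_split /= !sumrN -!mulr_suml !sumr_const card_subcode_pairs.
have -> : \sum_(u : K * L2 | word u.1 u.2 \in V) (u.2 == 0)%:R = h%:Z.
  rewrite -natr_sum natz; congr Posz; rewrite sum_nat_bool /h /subcode_head.
  rewrite -(card_image (f := fun a : K => (a, 0 : L2))); last by move=> a a' [].
  apply: eq_card => -[a b]; rewrite inE /=; apply/andP/imageP => [[/= + /eqP b0]|].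
    by rewrite b0 => aV; exists a.
  by move=> [a' a'V [-> ->]].
have -> : \sum_(u : K * L2 | word u.1 u.2 \in V) (u == 0)%:R = 1 :> int.
  rewrite (bigD1 ((0, 0) : K * L2)) /= ?word0 ?mem0v // eqxx big1 ?addr0 // => u /andP[_].
  by move/negbTE => ->.
rewrite -mulNrn -mulrnDl -[_ *+ (p ^ r)%N]mulr_natr natz.
by move: (p ^ r)%:Z (q%:Z ^+ (m1 + m2)) (q%:Z ^+ _.+1) (q%:Z ^+ m2 * _) => *; ring.
Qed.

End Subcode.

(** * Subcodes with extreme head *)

Lemma exists_word_vspace (S : {pred K * L2}) :
  (0, 0) \in S -> (forall u v, u \in S -> v \in S -> (u.1 + v.1, u.2 + v.2) \in S) ->
  exists V : {vspace 'M['F_p]_(#|{: Fstar L1 L2}|, len)},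
    [/\ forall u, (word u.1 u.2 \in V) = (u \in S), {subset V <= code}
      & #|S| = (p ^ \dim V)%N].
Proof.
move=> S0 SD; pose f u := word u.1 u.2.
have f_inj : injective f by move=> [a b] [a' b'] /word_inj[/= -> ->].
have [|_ _ /mapP[u uS ->] /mapP[v vS ->]|V VE] :=
  additive_set_vspace (s := [seq f u | u <- enum S]).
- by rewrite -word0; apply/mapP; exists (0, 0); rewrite ?mem_enum.
- rewrite -wordD; apply/mapP; exists (u.1 + v.1, u.2 + v.2) => //.
  by rewrite mem_enum in uS; rewrite mem_enum in vS; rewrite mem_enum SD.
have V_code : {subset V <= code}.
  by move=> W; rewrite VE => /mapP[u _ ->]; apply/codeP; exists u.
have VS u : (word u.1 u.2 \in V) = (u \in S) by rewrite VE (mem_map f_inj) mem_enum.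
exists V; split=> //; rewrite -(card_subcode_pairs V_code erefl).
by apply: eq_card => u; rewrite inE VS.
Qed.

Let p_gt1 := prime_gt1 p_pr.

Lemma exists_code_vspace :
  exists V : {vspace 'M['F_p]_(#|{: Fstar L1 L2}|, len)},
    V =i code /\ \dim V = (m * (m2 + 1))%N.
Proof.
have [//|//|V [VE V_code cardV]] := @exists_word_vspace predT.
exists V; split=> [W|].
  by apply/idP/idP => [/V_code //|/codeP[u ->]]; rewrite VE.
apply: (expnI p_gt1); rewrite -cardV card_prod cardK cardL2 -!expnM -expnD.
by congr (_ ^ _)%N; rewrite mulnDr muln1 addnC.
Qed.

(** Nest [V] with the [m]-dimensional space [A] of words with [b = 0]: inside [A] every word of [V]
    counts, and above [A] all [q] values of [a] occur. *)
Lemma exists_subcode_max_head r : (r <= m * (m2 + 1))%N ->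
  exists V : {vspace 'M['F_p]_(#|{: Fstar L1 L2}|, len)},
    [/\ {subset V <= code}, \dim V = r, (r <= m)%N -> subcode_head V = (p ^ r)%N
      & (m <= r)%N -> subcode_head V = q].
Proof.
move=> r_le; have [W [WE dimW]] := exists_code_vspace.
have [||A [AE A_code cardA]] := @exists_word_vspace [pred u | u.2 == 0].
- by rewrite inE.
- by move=> u v; rewrite !inE => /eqP -> /eqP ->; rewrite addr0.
have dimA : \dim A = m.
  apply: (expnI p_gt1); rewrite -cardA -/q -cardK.
  rewrite -(card_image (f := fun a : K => (a, 0 : L2))); last by move=> a a' [].
  apply: eq_card => -[a b]; rewrite inE /=; apply/eqP/imageP => [->|[a' _ []]//].
  by exists a.
have AW : (A <= W)%VS by apply/subvP => w /A_code; rewrite WE.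
have [|V [VW dimV VA AV]] := exists_subvs_between AW (r := r); rewrite ?dimW //.
have V_code : {subset V <= code} by move=> w /(subvP VW); rewrite WE.
rewrite dimA in VA AV; exists V; split=> // [/VA/subvP {}VA|/AV/subvP {}AV].
  apply/eqP; rewrite eqn_leq (head_le_card V_code dimV).
  rewrite -(card_subcode_pairs V_code dimV) /subcode_head.
  rewrite -(card_image (f := fun a : K => (a, 0 : L2))); last by move=> a a' [].
  apply: subset_leq_card; apply/subsetP => -[a b]; rewrite inE /= => abV.
  have := VA _ abV; rewrite (AE (a, b)) inE /= => /eqP b0.
  by rewrite b0 in abV *; apply/imageP; exists a.
rewrite -cardK; apply: eq_card => a; rewrite !inE.
by apply: AV; rewrite (AE (a, 0)) inE.
Qed.

(** Nest [V] with the space [B] of words with [a = 0]. Inside [B] only the zero word has [b = 0];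
    above [B], membership in [V] depends on [a] alone, so the pairs form a product with [L2]. *)
Lemma exists_subcode_min_head r : (r <= m * (m2 + 1))%N ->
  exists V : {vspace 'M['F_p]_(#|{: Fstar L1 L2}|, len)},
    [/\ {subset V <= code}, \dim V = r, (r <= m * m2)%N -> subcode_head V = 1%N
      & (m * m2 <= r)%N -> (subcode_head V * q ^ m2 = p ^ r)%N].
Proof.
move=> r_le; have [W [WE dimW]] := exists_code_vspace.
have [||B [BE B_code cardB]] := @exists_word_vspace [pred u | u.1 == 0].
- by rewrite inE.
- by move=> u v; rewrite !inE => /eqP -> /eqP ->; rewrite addr0.
have dimB : \dim B = (m * m2)%N.
  apply: (expnI p_gt1); rewrite -cardB expnM -/q -cardL2.
  rewrite -(card_image (f := fun b : L2 => (0 : K, b))); last by move=> b b' [].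
  apply: eq_card => -[a b]; rewrite inE /=; apply/eqP/imageP => [->|[b' _ []]//].
  by exists b.
have BW : (B <= W)%VS by apply/subvP => w /B_code; rewrite WE.
have [|V [VW dimV VB BV]] := exists_subvs_between BW (r := r); rewrite ?dimW //.
have V_code : {subset V <= code} by move=> w /(subvP VW); rewrite WE.
rewrite dimB in VB BV; exists V; split=> // [/VB/subvP {}VB|/BV/subvP {}BV].
  rewrite -(card1 (0 : K)); apply: eq_card => a; rewrite !inE.
  apply/idP/eqP => [/VB|->]; last by rewrite word0 mem0v.
  by rewrite (BE (a, 0)) inE => /eqP.
rewrite -(card_subcode_pairs V_code dimV) -cardL2 -sum_nat_const.
rewrite -(sum_nat_boolT (fun u => word u.1 u.2 \in V)).
rewrite -(pair_big xpredT xpredT (fun a b => word a b \in V : nat)) /=.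
rewrite big_mkcond; apply: eq_bigr => a _; rewrite inE.
have VE b : (word a b \in V) = (word a 0 \in V).
  rewrite -[a in LHS]addr0 -[b]add0r wordD rpredDr //.
  by apply: BV; rewrite (BE (0, b)) inE.
under eq_bigr do rewrite VE.
by rewrite sum_nat_const; case: (_ \in V); rewrite ?muln1 ?muln0.
Qed.

(** * Generalized Hamming weights according to the sign of the gain *)

Section Hierarchy.

Variable r : nat.
Hypothesis r_le : (r <= m * (m2 + 1))%N.

Let pr : rat := p%:R ^+ r.
Let base : rat := (q%:R ^+ (m1 + m2) * (q%:R - 1)) / (pr * N%:R).
(** The amount by which the support shrinks for each further word with [b = 0]. *)
Let gain : rat := q%:R ^+ m2 * (q%:R * zeros%:R - q%:R ^+ m1) / (pr * N%:R).

Lemma card_supp_rat (V : {vspace 'M['F_p]_(#|{: Fstar L1 L2}|, len)}) :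
  {subset V <= code} -> \dim V = r ->
  (#|supp_vs V|)%:R = base * (pr - 1) - gain * ((subcode_head V)%:R - 1).
Proof.
move=> V_code dimV; have p_neq0 : p%:R != 0 :> rat by rewrite pnatr_eq0 -lt0n prime_gt0.
have pr_neq0 : pr != 0 by rewrite expf_neq0.
have N_neq0 : N%:R != 0 :> rat by rewrite pnatr_eq0 -lt0n.
have := congr1 (fun z : int => z%:~R : rat) (card_supp_subcode V_code dimV).
rewrite rmorphD !rmorphM !rmorphB !rmorphM !rmorphXn /= rmorph1 -!pmulrn.
rewrite -/pr => suppE; apply: (mulfI N_neq0); apply: (mulIf pr_neq0).
rewrite suppE /base /gain natrX exprS exprD.
move: (p%:R ^+ m) => y; move: (y ^+ m1) (y ^+ m2) (pr) pr_neq0 => y1 y2 w w0.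
by field; rewrite w0 N_neq0.
Qed.

(** A large head is favourable here; [head_le_card] and [head_le_q] bound it, and
    [exists_subcode_max_head] attains the smaller bound. *)
Lemma GHW_gain_ge0 : 0 <= gain ->
  GHW_eq code r
    (base * (pr - 1) - gain * ((if (r <= m)%N then pr else q%:R) - 1)).
Proof.
move=> gain_ge0; have [V [V_code dimV VA AV]] := exists_subcode_max_head r_le.
have headV : (subcode_head V)%:R = if (r <= m)%N then pr else q%:R.
  by case: (leqP r m) => [/VA -> | /ltnW/AV ->]; rewrite // natrX.
exists #|supp_vs V|; rewrite card_supp_rat // headV; split=> //; split.
  by exists V.
move=> V' dimV' V'_code; rewrite -(ler_nat rat) !card_supp_rat // lerD2l lerN2.
rewrite ler_wpM2l // lerD2r headV; case: ifP => _.
  by rewrite /pr -natrX ler_nat head_le_card.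
by rewrite ler_nat head_le_q.
Qed.

(** A small head is favourable here; [head_ge1] and [card_le_head] bound it from below, and
    [exists_subcode_min_head] attains the larger bound. *)
Lemma GHW_gain_le0 : gain <= 0 ->
  GHW_eq code r (base * (pr - 1)
    - gain * ((if (r <= m * m2)%N then 1 else p%:R ^+ (r - m * m2)) - 1)).
Proof.
move=> gain_le0; have [V [V_code dimV VB BV]] := exists_subcode_min_head r_le.
have q_gt0 : (0 < q ^ m2)%N by rewrite !expn_gt0 prime_gt0.
have headV : (subcode_head V)%:R
    = if (r <= m * m2)%N then 1 else p%:R ^+ (r - m * m2) :> rat.
  case: (leqP r (m * m2)) => [/VB -> // | /ltnW le_r].
  rewrite -natrX; congr _%:R; apply/eqP; rewrite -(eqn_pmul2r q_gt0) BV //.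
  by rewrite -expnM -expnD subnK.
exists #|supp_vs V|; rewrite card_supp_rat // headV; split=> //; split.
  by exists V.
move=> V' dimV' V'_code; rewrite -(ler_nat rat) !card_supp_rat // lerD2l lerN2.
rewrite ler_wnM2l // lerD2r ler_nat.
case: (leqP r (m * m2)) => [/VB -> | /ltnW/BV hE]; first exact: head_ge1.
by rewrite -(leq_pmul2r q_gt0) hE card_le_head.
Qed.

End Hierarchy.

End DescendedCode.

(** * The sign epsilon and the zeros of Q *)

Lemma odd_half_predX p m : odd p -> odd (p ^ m).-1./2 = odd (m * p.-1./2).
Proof.
move=> p_odd; have [t ->] : exists t, p = t.*2.+1.
  by exists p./2; rewrite -[LHS]odd_double_half p_odd.
rewrite /= doubleK oddM; elim: m => [|m IHm]; first by rewrite expn0.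
have [u uE] : exists u, (t.*2.+1 ^ m = u.*2.+1)%N.
  exists (t.*2.+1 ^ m)./2; rewrite -[LHS]odd_double_half oddX /= odd_double orbT.
  by [].
move: IHm; rewrite uE /= doubleK => IHm; rewrite expnS uE.
(* Modulo 2, half the predecessor of a product of odd numbers is the sum [u + t] of the halves, so
   each factor [p] adds [p.-1./2]. *)
have -> : (t.*2.+1 * u.*2.+1 = (t.*2.+1 * u + t).*2.+1)%N by lia.
rewrite /= doubleK oddD oddM /= odd_double /= IHm.
by case: (odd m); case: (odd t).
Qed.

Lemma qchar_signX (p m k : nat) (K : finFieldType) :
  odd p -> #|K| = (p ^ m)%N ->
  qchar ((-1) ^+ k : K) = (-1) ^+ ((p - 1) * m * k.*2 %/ 4).
Proof.
move=> p_odd cardK.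
have oddK : odd #|K| by rewrite cardK oddX p_odd orbT.
rewrite qcharX // qcharN1 // cardK -exprM.
(* The division by 4 is exact, since [p - 1] and [k.*2] are both even. *)
have -> : ((p - 1) * m * k.*2 = (m * p.-1./2 * k) * 4)%N.
  have : (p - 1 = p.-1./2.*2)%N by lia.
  by move=> ->; nia.
by rewrite mulnK // -[LHS]signr_odd -[RHS]signr_odd !oddM odd_half_predX // oddM.
Qed.

Lemma card_qform_zeros (m1 rQ : nat) (K L1 : finFieldType) (iota1 : K -> L1)
    (Q : L1 -> K) (e : 'I_m1 -> L1) (lam : 'I_m1 -> K) :
  odd #|K| ->
  bijective (fun c : 'rV[K]_m1 => \sum_(i < m1) iota1 (c 0 i) * e i) ->
  (rQ <= m1)%N ->
  (forall i : 'I_m1, (i < rQ)%N -> lam i != 0) ->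
  (forall c : 'rV[K]_m1,
      Q (\sum_(i < m1) iota1 (c 0 i) * e i)
      = \sum_(i < m1 | (i < rQ)%N) lam i * (c 0 i) ^+ 2) ->
  #|K|%:Z * #|[pred x | Q x == 0]|%:Z = #|K|%:Z ^+ m1 +
    #|K|%:Z ^+ (m1 - rQ./2) * (if odd rQ then 0 else #|K|%:Z - 1) *
    qchar ((-1) ^+ rQ./2 * \prod_(i < m1 | (i < rQ)%N) lam i).
Proof.
move=> oddK bij rQ_le lam_neq0 QE.
(* Padding with zero coefficients gives a diagonal form in all [m1] coordinates, to which
   [diag_countE] applies at [t = 0]. *)
pose lam' (i : 'I_m1) := if (i < rQ)%N then lam i else 0.
have lam'_neq0 i : (lam' i != 0) = (i < rQ)%N.
  by rewrite /lam'; case: ifP => [/lam_neq0 -> //|]; rewrite eqxx.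
have := diag_countE oddK lam' 0.
have -> : (\sum_i (lam' i != 0%R) = rQ)%N.
  rewrite (eq_bigr (fun i : 'I_m1 => if (i < rQ)%N then 1 else 0)%N) => [|i _].
    rewrite -big_mkcond /= -(big_ord_widen _ (fun=> 1%N)) //.
    by rewrite sum_nat_const card_ord muln1.
  by rewrite lam'_neq0; case: (i < rQ)%N.
have -> : \prod_(i | lam' i != 0) lam' i = \prod_(i < m1 | (i < rQ)%N) lam i.
  by apply: eq_big => i; rewrite lam'_neq0 // /lam' => ->.
rewrite qchar0 /zero_wt eqxx => <-; congr (_ * _).
rewrite /diag_count -sum_nat_boolT (reindex _ (onW_bij _ bij)) /= -natz natr_sum.
apply: eq_bigr => c _; rewrite QE big_mkcond; congr (nat_of_bool (_ == _))%:R.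
by apply: eq_bigr => i _; rewrite /lam'; case: ifP; rewrite ?mul0r.
Qed.

Theorem theorem5
    (p m m1 m2 N : nat) (K L1 L2 : finFieldType)
    (iota1 : {rmorphism K -> L1}) (iota2 : {rmorphism K -> L2})
    (Q : L1 -> K) (e : 'I_m1 -> L1) (rQ : nat) (lam : 'I_m1 -> K)
    (theta : K) (r : nat) :
  prime p -> odd p -> (0 < m)%N -> (0 < m1)%N -> (0 < m2)%N ->
  #|K| = (p ^ m)%N -> #|L1| = ((p ^ m) ^ m1)%N -> #|L2| = ((p ^ m) ^ m2)%N ->
  (* Q is a nonzero quadratic form on F_{q1}/F_q *)
  is_qform iota1 Q -> (exists x : L1, Q x != 0) ->
  (* e is an F_q-basis of F_{q1} in whose coordinates
     Q = lam_0 x_0^2 + ... + lam_{rQ-1} x_{rQ-1}^2 with all lam_i <> 0 *)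
  bijective (fun c : 'rV[K]_m1 => \sum_(i < m1) iota1 (c 0 i) * e i) ->
  (rQ <= m1)%N ->
  (forall i : 'I_m1, (i < rQ)%N -> lam i != 0) ->
  (forall c : 'rV[K]_m1,
      Q (\sum_(i < m1) iota1 (c 0 i) * e i)
      = \sum_(i < m1 | (i < rQ)%N) lam i * (c 0 i) ^+ 2) ->
  (* N and theta *)
  (0 < N)%N -> (N %| p - 1)%N -> coprime N ((p ^ m - 1) %/ (p - 1)) ->
  ((p ^ m - 1) %/ N).-primitive_root theta ->
  (1 <= r <= m * (m2 + 1))%N ->
  let q := (p ^ m)%N in
  let M := (m1 + m2)%N in
  let C := @CQN p m m2 K L1 L2 iota2 Q theta ((q - 1) %/ N) in
  let epsQ : int := qchar (\prod_(i < m1 | (i < rQ)%N) lam i) in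
  let eps : int :=
    if ~~ odd rQ then epsQ * (-1) ^+ ((p - 1) * m * rQ %/ 4)
    else epsQ * (-1) ^+ ((p - 1) * m * rQ.+1 %/ 4) in
  let pr : rat := (p%:R) ^+ r in
  let base : rat := (q%:R ^+ M * (q%:R - 1)) / (pr * N%:R) in
  let qh : rat := (q%:R) ^- (rQ./2) in
  [/\ (~~ odd rQ -> eps = 1 ->
        GHW_eq C r (if (r <= m)%N then base * (pr - 1) * (1 - qh)
                    else base * (pr - 1 - qh * (q%:R - 1)))),
      (~~ odd rQ -> eps = -1 ->
        GHW_eq C r (if (r <= m * m2)%N then base * (pr - 1)
                    else base * (pr - 1 + qh * ((p%:R) ^+ (r - m * m2) - 1))))
    & (odd rQ -> GHW_eq C r (base * (pr - 1)))].
Proof.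
move=> p_pr p_odd m_gt0 m1_gt0 m2_gt0 cardK cardL1 cardL2 [QZ _ _ _ _] Q_neq0 bij.
move=> rQ_le lam_neq0 QE N_gt0 N_dvd N_coprime theta_prim /andP[_ r_le].
move=> q M C epsQ eps pr base qh.
have Q0 : Q 0 = 0 by rewrite -[0 in LHS](mulr0 (iota1 0)) QZ expr0n mul0r.
have oddK : odd #|K| by rewrite cardK oddX p_odd orbT.
have GHW_ge0 := GHW_gain_ge0 iota2 p_pr m_gt0 m2_gt0 cardK cardL1 cardL2 N_gt0 N_dvd
  N_coprime theta_prim Q0 Q_neq0 r_le.
have GHW_le0 := GHW_gain_le0 iota2 p_pr m_gt0 m2_gt0 cardK cardL1 cardL2 N_gt0 N_dvd
  N_coprime theta_prim Q0 Q_neq0 r_le.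
move: GHW_ge0 GHW_le0; rewrite -/q -/M -/pr -/base -/C.
set gain : rat := _ / _ => GHW_ge0 GHW_le0.
(* [delta] carries the sign of [gain], as [base] and [qh] are nonnegative; it is 0 for odd rank
   because [qchar 0 = 0]. *)
pose delta : int := if odd rQ then 0 else eps.
have q_gt1 : (1 < q)%N by rewrite /q -cardK finNzRing_gt1.
have q_neq0 : q%:R != 0 :> rat by rewrite pnatr_eq0 -lt0n ltnW.
have gainE : gain = base * qh * delta%:~R.
  have := card_qform_zeros oddK bij rQ_le lam_neq0 QE.
  rewrite cardK -/q; set z := #|_|.
  have -> : q%:Z ^+ m1 + q%:Z ^+ (m1 - rQ./2) * (if odd rQ then 0 else q%:Z - 1) *
      qchar ((-1) ^+ rQ./2 * \prod_(i < m1 | (i < rQ)%N) lam i) =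
      q%:Z ^+ m1 + q%:Z ^+ (m1 - rQ./2) * (q%:Z - 1) * delta.
    rewrite /delta; case: ifP => [_|/negbT rQ_even]; first by rewrite !mulr0 mul0r.
    (* The factor [(-1) ^+ rQ./2] of the zero count supplies the power of [-1] in [eps]. *)
    rewrite qcharM // (qchar_signX _ p_odd cardK) /eps rQ_even even_halfK //.
    by rewrite [_ ^+ _ * qchar _]mulrC.
  move=> /(congr1 (fun z : int => z%:~R : rat)).
  rewrite rmorphD !rmorphM rmorphB rmorph1 !rmorphXn /= -!pmulrn => zerosE.
  have half_le : (rQ./2 <= m1)%N by rewrite (leq_trans _ rQ_le) // -divn2 leq_div.
  have qR : q%:R = p%:R ^+ m :> rat by rewrite natrX.
  rewrite -qR in zerosE; rewrite /gain zerosE exprB ?unitfE // -/qh.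
  by rewrite /base /M exprD; ring.
have base_ge0 : 0 <= base.
  rewrite /base divr_ge0 ?mulr_ge0 ?exprn_ge0 ?ler0n //.
  by rewrite subr_ge0 ler1n ltnW.
have qh_ge0 : 0 <= qh by rewrite invr_ge0 exprn_ge0 // ler0n.
split=> [/negbTE rQ_even epsE|/negbTE rQ_even epsE|rQ_odd].
- have {}gainE : gain = base * qh by rewrite gainE /delta rQ_even epsE mulr1.
  have := GHW_ge0; rewrite gainE mulr_ge0 // => /(_ isT).
  by congr GHW_eq; case: ifP => _; ring.
- have {}gainE : gain = - (base * qh).
    by rewrite gainE /delta rQ_even epsE mulrN1.
  have := GHW_le0; rewrite gainE oppr_le0 mulr_ge0 // => /(_ isT).
  by congr GHW_eq; case: ifP => _; ring.
- have {}gainE : gain = 0 by rewrite gainE /delta rQ_odd mulr0.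
  (* With zero gain the head no longer matters, and the bound reduces to [base * (pr - 1)]. *)
  have := GHW_ge0; rewrite gainE lexx => /(_ isT).
  by rewrite mul0r subr0.
Qed.
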